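(* Let $A$ be a commutative semiring (not necessarily idempotent). An $A$-module is flat if and only if it is a filtered colimit of finite free $A$-modules.
   Context: Modules over $A$ are commutative monoids with compatible $A$-action; $\otimes_A$ is the tensor product. An $A$-module $M$ is flat if the functor $-\otimes_A M$ is exact (preserves finite limits and finite colimits). Finite free modules are those of the form $A^n$. *)

(* Defs.v *)
From HB Require Import structures.
From Stdlib Require List.
From mathcomp Require Import all_boot all_algebra.
Set Implicit Arguments. Unset Strict Implicit. Unset Printing Implicit Defensive.
Import GRing.Theory.
Local Open Scope ring_scope.

Record cat := Cat {
  Ob :> Type;
  Hom : Ob -> Ob -> Type;
  idc : forall a, Hom a a;
  comp : forall a b c, Hom b c -> Hom a b -> Hom a c;
  comp_id_l : forall a b (f : Hom a b), comp (idc b) f = f;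
  comp_id_r : forall a b (f : Hom a b), comp f (idc a) = f;
  comp_assoc : forall a b c d (h : Hom c d) (g : Hom b c) (f : Hom a b),
      comp h (comp g f) = comp (comp h g) f }.
Arguments idc {c} a : rename.
Arguments comp {c a b c0} g f : rename.

Definition finite_cat (C : cat) : Prop :=
  (exists s : seq C, forall x : C, Stdlib.Lists.List.In x s) /\
  (forall a b : C, exists s : seq (Hom a b), forall f, Stdlib.Lists.List.In f s).

Definition filtered (C : cat) : Prop :=
  [/\ inhabited (Ob C),
      (forall a b : C, exists c : C, inhabited (Hom a c) /\ inhabited (Hom b c))
    & (forall (a b : C) (f g : Hom a b),
         exists (c : C) (h : Hom b c), comp h f = comp h g)].

Section ModuleDefs.
Variable A : comPzSemiRingType.
Local Notation mod := (lSemiModType A).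

Definition is_lin (M N : mod) (f : M -> N) : Prop :=
  [/\ f 0 = 0, (forall x y, f (x + y) = f x + f y)
    & (forall (a : A) x, f (a *: x) = a *: f x)].

Definition is_iso (M N : mod) (f : M -> N) : Prop := is_lin f /\ bijective f.

Definition finite_free (N : mod) : Prop :=
  exists n : nat, exists f : 'rV[A]_n -> N, is_iso f.

Definition is_bilin (N M P : mod) (b : N -> M -> P) : Prop :=
  (forall m, is_lin (fun n => b n m)) /\ (forall n, is_lin (b n)).

Definition is_tensor (N M T : mod) (t : N -> M -> T) : Prop :=
  is_bilin t /\
  forall (P : mod) (b : N -> M -> P), is_bilin b ->
    exists phi : T -> P,
      [/\ is_lin phi, (forall n m, phi (t n m) = b n m)
        & forall psi : T -> P, is_lin psi -> (forall n m, psi (t n m) = b n m) ->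
            forall x, psi x = phi x].

Record diagram (C : cat) := Diagram {
  dob : C -> mod;
  dmap : forall a b : C, Hom a b -> dob a -> dob b;
  dmap_lin : forall a b (f : Hom a b), is_lin (dmap f);
  dmap_id : forall a x, dmap (idc a) x = x;
  dmap_comp : forall a b c (g : Hom b c) (f : Hom a b) x,
      dmap (comp g f) x = dmap g (dmap f x) }.
Arguments dob {C} d j : rename.
Arguments dmap {C} d {a b} f _ : rename.

Definition is_cone (C : cat) (D : diagram C) (L : mod)
    (pi : forall j : C, L -> dob D j) : Prop :=
  (forall j, is_lin (pi j)) /\
  (forall (a b : C) (f : Hom a b) x, dmap D f (pi a x) = pi b x).
Arguments is_cone {C} D {L} pi : rename.

Definition is_limit (C : cat) (D : diagram C) (L : mod)
    (pi : forall j : C, L -> dob D j) : Prop :=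
  is_cone D pi /\
  forall (L' : mod) (pi' : forall j : C, L' -> dob D j), is_cone D pi' ->
    exists u : L' -> L,
      [/\ is_lin u, (forall j x, pi j (u x) = pi' j x)
        & forall v : L' -> L, is_lin v -> (forall j x, pi j (v x) = pi' j x) ->
            forall x, v x = u x].
Arguments is_limit {C} D {L} pi : rename.

Definition is_cocone (C : cat) (D : diagram C) (L : mod)
    (iota : forall j : C, dob D j -> L) : Prop :=
  (forall j, is_lin (iota j)) /\
  (forall (a b : C) (f : Hom a b) x, iota b (dmap D f x) = iota a x).
Arguments is_cocone {C} D {L} iota : rename.

Definition is_colimit (C : cat) (D : diagram C) (L : mod)
    (iota : forall j : C, dob D j -> L) : Prop :=
  is_cocone D iota /\
  forall (L' : mod) (iota' : forall j : C, dob D j -> L'), is_cocone D iota' ->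
    exists u : L -> L',
      [/\ is_lin u, (forall j x, u (iota j x) = iota' j x)
        & forall v : L -> L', is_lin v -> (forall j x, v (iota j x) = iota' j x) ->
            forall x, v x = u x].
Arguments is_colimit {C} D {L} iota : rename.

(* E (with maps t) is the diagram D (x)_A M, i.e. the image of D under - (x)_A M *)
Definition is_tensor_diagram (C : cat) (D : diagram C) (M : mod)
    (E : diagram C) (t : forall j : C, dob D j -> M -> dob E j) : Prop :=
  (forall j, is_tensor (t j)) /\
  (forall (a b : C) (f : Hom a b) x m, dmap E f (t a x m) = t b (dmap D f x) m).
Arguments is_tensor_diagram {C} D {M} E t : rename.

Definition tensor_preserves_finite_limits (M : mod) : Prop :=
  forall (C : cat), finite_cat C ->
  forall (D : diagram C) (L : mod) (pi : forall j : C, L -> dob D j),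
    is_limit D pi ->
  forall (E : diagram C) (t : forall j : C, dob D j -> M -> dob E j),
    is_tensor_diagram D E t ->
  forall (TL : mod) (tL : L -> M -> TL), is_tensor tL ->
  forall rho : forall j : C, TL -> dob E j,
    (forall j, is_lin (rho j)) ->
    (forall j x m, rho j (tL x m) = t j (pi j x) m) ->
    is_limit E rho.

Definition tensor_preserves_finite_colimits (M : mod) : Prop :=
  forall (C : cat), finite_cat C ->
  forall (D : diagram C) (L : mod) (iota : forall j : C, dob D j -> L),
    is_colimit D iota ->
  forall (E : diagram C) (t : forall j : C, dob D j -> M -> dob E j),
    is_tensor_diagram D E t ->
  forall (TL : mod) (tL : L -> M -> TL), is_tensor tL ->
  forall kappa : forall j : C, dob E j -> TL,
    (forall j, is_lin (kappa j)) ->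
    (forall j x m, kappa j (t j x m) = tL (iota j x) m) ->
    is_colimit E kappa.

Definition flat (M : mod) : Prop :=
  tensor_preserves_finite_limits M /\ tensor_preserves_finite_colimits M.

Definition filtered_colimit_of_finite_free (M : mod) : Prop :=
  exists (I : cat) (F : diagram I) (iota : forall i : I, dob F i -> M),
    [/\ filtered I, (forall i, finite_free (dob F i)) & is_colimit F iota].

End ModuleDefs.

(* Main.v *)
Require Import Defs.
From HB Require Import structures.
From mathcomp Require Import all_boot all_algebra.
From mathcomp Require Import boolp.

(** If M is a filtered colimit of free modules A^(n i), then N (x) M is the
    filtered colimit of the powers N^(n i): each of its elements has a
    representative at some stage, and two representatives at one stage are equal
    in N (x) M iff they become equal at a later one. A finite limit involves
    finitely many elements and equations, so all of them can be met at one stage,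
    where the limit is taken componentwise. Colimits are preserved because
    - (x) M is left adjoint to Hom(M, -).

    Conversely, any M is the colimit of the A^n over its category of elements,
    whose objects are the finite families of M. Parallel arrows u, v : (n, x) ->
    (m, y) are coequalized by tensoring the equalizer of u, v : A^m -> A^n with M:
    the family y satisfies u y = v y, hence comes from a finite sum of tensors
    c_q (x) z_q with u c_q = v c_q, and the columns c_q form the wanted arrow. *)

Set Implicit Arguments. Unset Strict Implicit. Unset Printing Implicit Defensive.
Import GRing.Theory Defs.
Local Open Scope ring_scope.

Arguments dob {A C} d j : rename.
Arguments dmap {A C} d {a b} f _ : rename.
Arguments is_cone {A C} D {L} pi : rename.
Arguments is_limit {A C} D {L} pi : rename.
Arguments is_cocone {A C} D {L} iota : rename.
Arguments is_colimit {A C} D {L} iota : rename.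
Arguments is_tensor_diagram {A C} D {M} E t : rename.

(** * Quotient semimodules *)

(** The semimodules built below (germs, words of tensors, linear maps, equalizers) are given by
    representatives satisfying the laws only up to an equivalence; a single quotient construction
    turns all of them into genuine semimodules. *)
Record semimod_setoid (A : pzSemiRingType) := SemimodSetoid {
  car :> Type;
  sim : car -> car -> Prop;
  szero : car;
  sadd : car -> car -> car;
  sscale : A -> car -> car;
  sim_refl : forall x, sim x x;
  sim_sym : forall x y, sim x y -> sim y x;
  sim_trans : forall x y z, sim x y -> sim y z -> sim x z;
  sadd_sim : forall x x' y y',
    sim x x' -> sim y y' -> sim (sadd x y) (sadd x' y');
  sscale_sim : forall a x x', sim x x' -> sim (sscale a x) (sscale a x');
  saddA : forall x y z, sim (sadd x (sadd y z)) (sadd (sadd x y) z);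
  saddC : forall x y, sim (sadd x y) (sadd y x);
  sadd0 : forall x, sim (sadd szero x) x;
  sscaleA : forall a b x, sim (sscale a (sscale b x)) (sscale (a * b) x);
  sscale0 : forall x, sim (sscale 0 x) szero;
  sscale1 : forall x, sim (sscale 1 x) x;
  sscaleDr : forall a x y,
    sim (sscale a (sadd x y)) (sadd (sscale a x) (sscale a y));
  sscaleDl : forall x a b,
    sim (sscale (a + b) x) (sadd (sscale a x) (sscale b x)) }.

Section Quotient.
Variables (A : pzSemiRingType) (S : semimod_setoid A).

(** A class is the predicate [sim x] itself, so that extensionality turns equivalence of
    representatives into equality of classes. Representatives are recovered by classical choice. *)
Definition quot := {P : S -> Prop | exists x, P = sim x}.
Definition quot_pi (x : S) : quot := exist _ _ (ex_intro _ x erefl).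
Definition quot_repr (q : quot) : S := sval (cid (proj2_sig q)).

Lemma quot_eqP x y : quot_pi x = quot_pi y <-> sim x y.
Proof.
split=> [[E]|xy]; first by rewrite E; exact: sim_refl.
apply: eq_exist => /=; apply/funext => z; apply/propext; split=> h.
  exact: sim_trans (sim_sym xy) h.
exact: sim_trans xy h.
Qed.

Lemma quot_piK q : quot_pi (quot_repr q) = q.
Proof.
rewrite /quot_repr; case: (cid _) => x /= E; case: q E => P h /= E.
exact/eq_exist.
Qed.

Lemma quot_reprK x : sim (quot_repr (quot_pi x)) x.
Proof. by apply/quot_eqP; rewrite quot_piK. Qed.

Definition quot_add p q := quot_pi (sadd (quot_repr p) (quot_repr q)).
Definition quot_scale a q := quot_pi (sscale a (quot_repr q)).

Lemma quot_addE x y : quot_add (quot_pi x) (quot_pi y) = quot_pi (sadd x y).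
Proof. by apply/quot_eqP/sadd_sim; exact: quot_reprK. Qed.

Lemma quot_scaleE a x : quot_scale a (quot_pi x) = quot_pi (sscale a x).
Proof. by apply/quot_eqP/sscale_sim; exact: quot_reprK. Qed.

Lemma quot_addA : associative quot_add.
Proof.
move=> p q r; rewrite -(quot_piK p) -(quot_piK q) -(quot_piK r) !quot_addE.
exact/quot_eqP/saddA.
Qed.

Lemma quot_addC : commutative quot_add.
Proof. by move=> p q; apply/quot_eqP/saddC. Qed.

Lemma quot_add0 : left_id (quot_pi (szero S)) quot_add.
Proof.
by move=> p; rewrite -(quot_piK p) quot_addE; apply/quot_eqP/sadd0.
Qed.

HB.instance Definition _ := gen_eqMixin quot.
HB.instance Definition _ := gen_choiceMixin quot.
HB.instance Definition _ :=
  GRing.isNmodule.Build quot quot_addA quot_addC quot_add0.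

Lemma quot_piD x y : quot_pi (sadd x y) = quot_pi x + quot_pi y.
Proof. by rewrite -quot_addE. Qed.

Lemma quot_scaleA a b q : quot_scale a (quot_scale b q) = quot_scale (a * b) q.
Proof.
by rewrite -(quot_piK q) !quot_scaleE; apply/quot_eqP/sscaleA.
Qed.

Lemma quot_scale0 q : quot_scale 0 q = 0.
Proof. exact/quot_eqP/sscale0. Qed.

Lemma quot_scale1 : left_id 1 quot_scale.
Proof.
by move=> q; rewrite -(quot_piK q) quot_scaleE; apply/quot_eqP/sscale1.
Qed.

Lemma quot_scaleDr : right_distributive quot_scale +%R.
Proof.
move=> a p q; rewrite -(quot_piK p) -(quot_piK q) -quot_piD !quot_scaleE -quot_piD.
exact/quot_eqP/sscaleDr.
Qed.

Lemma quot_scaleDl q : {morph quot_scale^~ q : a b / a + b}.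
Proof.
move=> a b; rewrite -(quot_piK q) /= !quot_scaleE [RHS]quot_addE.
exact/quot_eqP/sscaleDl.
Qed.

HB.instance Definition _ := GRing.Nmodule_isLSemiModule.Build A quot
  quot_scaleA quot_scale0 quot_scale1 quot_scaleDr quot_scaleDl.

Lemma quot_piZ a x : quot_pi (sscale a x) = a *: quot_pi x.
Proof. by rewrite -quot_scaleE. Qed.

Lemma quot_pi0 : quot_pi (szero S) = 0.
Proof. by []. Qed.

End Quotient.

(** * Linear maps, and limits described by elements *)

Section LinearMaps.
Variable A : comPzSemiRingType.
Implicit Types M N P : lSemiModType A.

Lemma lin0 M N (f : M -> N) : is_lin f -> f 0 = 0.
Proof. by case. Qed.

Lemma linD M N (f : M -> N) : is_lin f -> {morph f : x y / x + y}.
Proof. by case. Qed.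

Lemma linZ M N (f : M -> N) : is_lin f -> forall a x, f (a *: x) = a *: f x.
Proof. by case. Qed.

Lemma lin_sum M N (f : M -> N) (I : Type) (r : seq I) (F : I -> M) :
  is_lin f -> f (\sum_(i <- r) F i) = \sum_(i <- r) f (F i).
Proof. by move=> fL; apply: (big_morph f (linD fL) (lin0 fL)). Qed.

Lemma lin_id M : is_lin (fun x : M => x).
Proof. by split. Qed.

Lemma lin_comp M N P (g : N -> P) (f : M -> N) :
  is_lin g -> is_lin f -> is_lin (fun x => g (f x)).
Proof.
move=> gL fL; split=> [|x y|a x]; first by rewrite (lin0 fL) (lin0 gL).
  by rewrite (linD fL) (linD gL).
by rewrite (linZ fL) (linZ gL).
Qed.

Lemma lin_inv M N (f : M -> N) (g : N -> M) :
  is_lin f -> cancel f g -> cancel g f -> is_lin g.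
Proof.
move=> fL fK gK; split=> [|x y|a x]; apply: (can_inj fK).
- by rewrite gK (lin0 fL).
- by rewrite (linD fL) !gK.
- by rewrite (linZ fL) !gK.
Qed.

End LinearMaps.

(* The elements of a limit are probed by linear maps out of the free module A. *)
Lemma is_limitP (A : comPzSemiRingType) (C : cat) (D : diagram A C)
    (L : lSemiModType A) (pi : forall j : C, L -> dob D j) :
  is_limit D pi <->
  is_cone D pi /\
  forall x : (forall j, dob D j),
    (forall (a b : C) (f : Hom a b), dmap D f (x a) = x b) ->
    exists! l, forall j, pi j l = x j.
Proof.
split=> [[cpi U]|[cpi U]]; split=> //.
  have [piL _] := cpi.
  move=> x xc.
  have scale_lin (N : lSemiModType A) (n : N) : is_lin (fun a : A^o => (a : A) *: n).
    split=> [|a b|a b]; first exact: scale0r.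
      by rewrite scalerDl.
    by rewrite scalerA.
  have [|u [uL uE uU]] := U A^o (fun j (a : A^o) => (a : A) *: x j).
    split=> [j|a b f c]; first exact: scale_lin.
    by rewrite (linZ (dmap_lin D f)) xc.
  exists (u 1); split=> [j|l lE]; first by rewrite uE scale1r.
  rewrite -[RHS]scale1r; symmetry; apply: (uU (fun a : A^o => (a : A) *: l)) => //.
  by move=> j a; rewrite (linZ (piL j)) lE.
move=> L' pi' [pi'L pi'C].
have [piL piC] := cpi.
have /choice[u uE] (x : L') : exists l, forall j, pi j l = pi' j x.
  have [|l [lE _]] := U (fun j => pi' j x); first by move=> a b f; apply: pi'C.
  by exists l.
(* The projections are jointly injective; linearity and uniqueness of the mediating map are then
   checked after projecting. *)
have inj l l' : (forall j, pi j l = pi j l') -> l = l'.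
  move=> E; have [|k [_ kU]] := U (fun j => pi j l').
    by move=> a b f; apply: piC.
  by rewrite -(kU l) // -(kU l').
exists u; split=> //.
  split=> [|x y|a x]; apply: inj => j.
  - by rewrite uE (lin0 (piL j)) (lin0 (pi'L j)).
  - by rewrite (linD (piL j)) !uE (linD (pi'L j)).
  - by rewrite (linZ (piL j)) !uE (linZ (pi'L j)).
by move=> v _ vE x; apply: inj => j; rewrite vE uE.
Qed.

(** * Filtered colimits *)

Section Filtered.
Variables (I : cat) (hI : filtered I).

Lemma filtered_ub2 (i j : I) : exists (k : I) (f : Hom i k) (g : Hom j k), True.
Proof. by have [_ /(_ i j)[k [[f] [g]]] _] := hI; exists k, f, g. Qed.

Lemma filtered_ub3 (i j l : I) :
  exists (k : I) (f : Hom i k) (g : Hom j k) (h : Hom l k), True.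
Proof.
have [k [f [g _]]] := filtered_ub2 i j; have [k' [u [h _]]] := filtered_ub2 k l.
by exists k', (comp u f), (comp u g), h.
Qed.

Lemma filtered_span (i j j' : I) (f : Hom i j) (f' : Hom i j') :
  exists (k : I) (g : Hom j k) (g' : Hom j' k), comp g f = comp g' f'.
Proof.
have [k [g [g' _]]] := filtered_ub2 j j'.
have [_ _ /(_ _ _ (comp g f) (comp g' f'))[l [h hE]]] := hI.
by exists l, (comp h g), (comp h g'); rewrite -!comp_assoc.
Qed.

(** Finitely many conditions, each reachable from [i] and persistent along further arrows, are met
    at one stage: the arrow for the tail and the one for the head form a span out of [i], which is
    completed to a commuting square. This is where finiteness of the limit shape enters. *)
Lemma filtered_seq (i : I) (X : Type) (s : seq X)
    (P : X -> forall j, Hom i j -> Prop) :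
  (forall x j (f : Hom i j) k (g : Hom j k), P x j f -> P x k (comp g f)) ->
  (forall x, exists j f, P x j f) ->
  exists j f, forall x, List.In x s -> P x j f.
Proof.
move=> Pstable Pex; elim: s => [|x s [j [f fP]]].
  by exists i, (idc i).
have [j' [f' f'P]] := Pex x.
have [k [g [g' E]]] := filtered_span f f'.
exists k, (comp g f) => y [<-|ys]; first by rewrite E; apply: Pstable.
exact/Pstable/fP.
Qed.

End Filtered.

Section FilteredColimit.
Variables (A : comPzSemiRingType) (I : cat) (hI : filtered I) (D : diagram A I).

Let germ := {i : I & dob D i}.
Let germ_at (i : I) (x : dob D i) : germ := existT _ i x.

Let germ_sim (p q : germ) := exists k f g,
  dmap D (b := k) f (projT2 p) = dmap D g (projT2 q).

(** Addition of germs has to be a function, so an upper bound of each pair of stages is fixed by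
    choice. *)
Let ub (i j : I) : {k : I & (Hom i k * Hom j k)%type}.
Proof.
have /cid[s _] : exists s : {k : I & (Hom i k * Hom j k)%type}, True.
  by have [k [f [g _]]] := filtered_ub2 hI i j; exists (existT _ k (f, g)).
exact: s.
Qed.

Let base : I.
Proof.
have /cid[i _] : exists i : I, True by have [[i] _ _] := hI; exists i.
exact: i.
Qed.

Let germ_zero : germ := germ_at (0 : dob D base).
Let germ_add (p q : germ) : germ :=
  let u := ub (projT1 p) (projT1 q) in
  germ_at (dmap D (projT2 u).1 (projT2 p) + dmap D (projT2 u).2 (projT2 q)).
Let germ_scale (a : A) (p : germ) : germ := germ_at (a *: projT2 p).

Lemma germ_sim_refl p : germ_sim p p.
Proof. by exists (projT1 p), (idc _), (idc _). Qed.

Lemma germ_sim_sym p q : germ_sim p q -> germ_sim q p.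
Proof. by case=> k [f [g E]]; exists k, g, f. Qed.

Lemma germ_sim_trans p q r : germ_sim p q -> germ_sim q r -> germ_sim p r.
Proof.
case=> k [f [g E]] [k' [f' [g' E']]].
have [l [h [h' hE]]] := filtered_span hI g f'.
exists l, (comp h f), (comp h' g').
by rewrite !dmap_comp E -E' -!dmap_comp hE.
Qed.

Lemma germ_sim_map i k (f : Hom i k) x : germ_sim (germ_at x) (germ_at (dmap D f x)).
Proof. by exists k, f, (idc k); rewrite dmap_id. Qed.

(** The sum does not depend on the bound chosen by [ub]: any common stage may be used. The remaining
    laws reduce to this. *)
Lemma germ_add_via p q k f g :
  germ_sim (germ_add p q)
    (germ_at (dmap D (b := k) f (projT2 p) + dmap D g (projT2 q))).
Proof.
case: p q f g => i x [j y] /= f g.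
rewrite /germ_add /=; case: (ub i j) => k0 [u v] /=.
(* The two bounds are first merged so that the routes from [i] agree; the two routes from [j] are
   then coequalized by a further arrow [h]. *)
have [l1 [a1 [b1 E1]]] := filtered_span hI u f.
have [_ _ /(_ _ _ (comp a1 v) (comp b1 g))[l [h hE]]] := hI.
exists l, (comp h a1), (comp h b1); rewrite /= !(linD (dmap_lin D _)) -!dmap_comp.
by rewrite -!comp_assoc E1 hE.
Qed.

Arguments germ_add_via : clear implicits.

Lemma germ_add_at k (x y : dob D k) :
  germ_sim (germ_add (germ_at x) (germ_at y)) (germ_at (x + y)).
Proof.
by have := germ_add_via (germ_at x) (germ_at y) k (idc k) (idc k); rewrite /= !dmap_id.
Qed.

Lemma germ_add_sim p p' q q' :
  germ_sim p p' -> germ_sim q q' -> germ_sim (germ_add p q) (germ_add p' q').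
Proof.
case=> k [f [g E]] [k' [f' [g' E']]].
have [l [u [v _]]] := filtered_ub2 hI k k'.
apply: germ_sim_trans (germ_add_via _ _ _ (comp u f) (comp v f')) _.
apply: germ_sim_sym.
apply: germ_sim_trans (germ_add_via _ _ _ (comp u g) (comp v g')) _.
by rewrite !dmap_comp E E'; apply: germ_sim_refl.
Qed.

Lemma germ_scale_sim a p p' :
  germ_sim p p' -> germ_sim (germ_scale a p) (germ_scale a p').
Proof.
case=> k [f [g E]]; exists k, f, g.
by rewrite /= !(linZ (dmap_lin D _)) E.
Qed.

Lemma germ_addC p q : germ_sim (germ_add p q) (germ_add q p).
Proof.
have [k [f [g _]]] := filtered_ub2 hI (projT1 p) (projT1 q).
apply: germ_sim_trans (germ_add_via _ _ _ f g) _; rewrite addrC.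
exact/germ_sim_sym/germ_add_via.
Qed.

Lemma germ_addA p q r :
  germ_sim (germ_add p (germ_add q r)) (germ_add (germ_add p q) r).
Proof.
case: p q r => [i x] [j y] [l z].
have [k [f [g [h _]]]] := filtered_ub3 hI i j l.
(* All three germs are moved to one stage, where associativity is that of the module there. *)
have [[fx gy] hz] := (germ_sim_map f x, germ_sim_map g y, germ_sim_map h z).
have lhs := germ_sim_trans (germ_add_sim fx
  (germ_sim_trans (germ_add_sim gy hz) (germ_add_at _ _))) (germ_add_at _ _).
have rhs := germ_sim_trans (germ_add_sim
  (germ_sim_trans (germ_add_sim fx gy) (germ_add_at _ _)) hz) (germ_add_at _ _).
rewrite addrA in lhs; exact: germ_sim_trans lhs (germ_sim_sym rhs).
Qed.

Lemma germ_add0 p : germ_sim (germ_add germ_zero p) p.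
Proof.
case: p => i x; have [k [f [g _]]] := filtered_ub2 hI base i.
apply: germ_sim_trans (germ_add_via germ_zero (germ_at x) _ f g) _.
rewrite (lin0 (dmap_lin D f)) add0r.
exact/germ_sim_sym/germ_sim_map.
Qed.

Lemma germ_scaleA a b p :
  germ_sim (germ_scale a (germ_scale b p)) (germ_scale (a * b) p).
Proof. by rewrite /germ_scale /= scalerA; apply: germ_sim_refl. Qed.

Lemma germ_scale0 p : germ_sim (germ_scale 0 p) germ_zero.
Proof.
have [k [f [g _]]] := filtered_ub2 hI (projT1 p) base.
by exists k, f, g; rewrite /= scale0r !(lin0 (dmap_lin D _)).
Qed.

Lemma germ_scale1 p : germ_sim (germ_scale 1 p) p.
Proof. by case: p => i x; rewrite /germ_scale /= scale1r; apply: germ_sim_refl. Qed.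

Lemma germ_scaleDr a p q :
  germ_sim (germ_scale a (germ_add p q)) (germ_add (germ_scale a p) (germ_scale a q)).
Proof.
rewrite /germ_scale /germ_add /= scalerDr !(linZ (dmap_lin D _)).
exact: germ_sim_refl.
Qed.

Lemma germ_scaleDl p a b :
  germ_sim (germ_scale (a + b) p) (germ_add (germ_scale a p) (germ_scale b p)).
Proof.
by rewrite /germ_scale scalerDl; apply/germ_sim_sym/germ_add_at.
Qed.

Let germ_setoid : semimod_setoid A := SemimodSetoid
  germ_sim_refl germ_sim_sym germ_sim_trans germ_add_sim germ_scale_sim
  germ_addA germ_addC germ_add0 germ_scaleA germ_scale0 germ_scale1
  germ_scaleDr germ_scaleDl.

(** The quotient of the germs is a colimit in which elements and equalities are visible at a stage.
    The universal property alone does not show these two facts. *)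
Lemma filtered_colimit_exists :
  exists (Q : lSemiModType A) (kap : forall i, dob D i -> Q),
  [/\ is_colimit D kap,
      (forall q, exists i x, q = kap i x)
    & (forall i x x', kap i x = kap i x' ->
         exists k (f : Hom i k), dmap D f x = dmap D f x')].
Proof.
pose pi := @quot_pi A germ_setoid.
pose kap i (x : dob D i) : quot germ_setoid := pi (germ_at x).
have kapS q : exists i x, q = kap i x.
  by rewrite -[q]quot_piK; case: (quot_repr q) => i x; exists i, x.
have kapE i j x y : kap i x = kap j y <->
    exists k f g, dmap D (b := k) f x = dmap D g y by exact: quot_eqP.
have kapD i x y : kap i (x + y) = kap i x + kap i y.
  rewrite /kap /pi -quot_piD; apply/quot_eqP.
  exact/germ_sim_sym/germ_add_at.
have kapZ i a x : kap i (a *: x) = a *: kap i x by rewrite /kap /pi -quot_piZ.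
have kapL i : is_lin (kap i).
  by split=> //; rewrite -[X in kap i X](scale0r 0) kapZ scale0r.
have kapC : is_cocone D kap.
  split=> // a b f x; apply/kapE; exists b, (idc b), f; exact: dmap_id.
have kap2 (q r : quot germ_setoid) : exists i x y, q = kap i x /\ r = kap i y.
  have [i [x ->]] := kapS q; have [j [y ->]] := kapS r.
  have [k [f [g _]]] := filtered_ub2 hI i j.
  by exists k, (dmap D f x), (dmap D g y); have [_ c] := kapC; rewrite !c.
exists (quot germ_setoid), kap; split=> //.
  split=> // L' iota' [iL iC].
  have /choice[u uE] (q : quot germ_setoid) :
      exists l, forall i x, q = kap i x -> l = iota' i x.
    have [i [x ->]] := kapS q; exists (iota' i x) => j y /kapE[k [f [g E]]].
    by rewrite -(iC _ _ f) E iC.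
  have uk i x : u (kap i x) = iota' i x by exact: uE.
  exists u; split=> //.
    split=> [|q r|a q].
    - by rewrite -(lin0 (kapL base)) uk (lin0 (iL base)).
    - by have [i [x [y [-> ->]]]] := kap2 q r; rewrite -kapD !uk (linD (iL i)).
    - by have [i [x ->]] := kapS q; rewrite -kapZ !uk (linZ (iL i)).
  by move=> v _ vE q; have [i [x ->]] := kapS q; rewrite vE uk.
move=> i x x' /kapE[k [f [g E]]].
(* Equality of germs provides two different arrows [f] and [g] out of [i]; coequalizing them leaves
   a single arrow that identifies [x] and [x']. *)
have [_ _ /(_ _ _ f g)[l [h hE]]] := hI.
exists l, (comp h f).
by rewrite {2}hE !dmap_comp E.
Qed.

(** Colimits are unique up to isomorphism, so surjectivity passes from the germ model to any
    colimit; only the composite of [L] to the model and back being the identity is used. *)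
Lemma filtered_colimit_surj (L : lSemiModType A) (iota : forall i, dob D i -> L) :
  is_colimit D iota -> forall l, exists i x, l = iota i x.
Proof.
move=> [iC iU] l.
have [Q [kap [[kC kU] kS _]]] := filtered_colimit_exists.
have [u [uL uE _]] := iU Q kap kC.
have [r [rL rE _]] := kU L iota iC.
have [w [_ _ wU]] := iU L iota iC.
have lE : r (u l) = l.
  transitivity (w l); last by symmetry; apply: (wU id).
  apply: (wU (fun x => r (u x))); first exact: lin_comp.
  by move=> i x; rewrite uE rE.
by have [i [x xE]] := kS (u l); exists i, x; rewrite -lE xE rE.
Qed.

End FilteredColimit.

(** * Tensor products *)

Section Tensor.
Variable A : comPzSemiRingType.
Implicit Types L M N P T : lSemiModType A.

Lemma bilin0r N M P (b : N -> M -> P) n : is_bilin b -> b n 0 = 0.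
Proof. by case=> _ h; exact: lin0. Qed.

Lemma bilinDr N M P (b : N -> M -> P) n : is_bilin b -> {morph b n : x y / x + y}.
Proof. by case=> _ h; exact: linD. Qed.

Lemma bilinZr N M P (b : N -> M -> P) n a m : is_bilin b -> b n (a *: m) = a *: b n m.
Proof. by case=> _ h; exact: linZ. Qed.

Lemma bilin0l N M P (b : N -> M -> P) m : is_bilin b -> b 0 m = 0.
Proof. by case=> h _; exact: (lin0 (h m)). Qed.

Lemma bilinDl N M P (b : N -> M -> P) m :
  is_bilin b -> {morph b^~ m : x y / x + y}.
Proof. by case=> h _; exact: (linD (h m)). Qed.

Lemma bilinZl N M P (b : N -> M -> P) n a m : is_bilin b -> b (a *: n) m = a *: b n m.
Proof. by case=> h _; exact: (linZ (h m)). Qed.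

Lemma tensor_ext N M T (t : N -> M -> T) P (f g : T -> P) :
  is_tensor t -> is_lin f -> is_lin g ->
  (forall n m, f (t n m) = g (t n m)) -> forall z, f z = g z.
Proof.
move=> [tb tU] fL gL E z.
have [|u [_ _ uU]] := tU P (fun n m => g (t n m)).
  split=> [m|n]; apply: (lin_comp gL); [exact: tb.1|exact: tb.2].
by rewrite (uU f) // (uU g).
Qed.

Section Construction.
Variables N M : lSemiModType A.

Let word_eval P (b : N -> M -> P) (s : seq (N * M)) := \sum_(p <- s) b p.1 p.2.

(* Words with the same value under every bilinear map; quantifying over all
   bilinear maps replaces the congruence generated by the tensor relations. *)
Let word_sim (s s' : seq (N * M)) :=
  forall P (b : N -> M -> P), is_bilin b -> word_eval b s = word_eval b s'.

Let word_scale (a : A) (s : seq (N * M)) := [seq (a *: p.1, p.2) | p <- s].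

Lemma word_eval_cat P (b : N -> M -> P) s s' :
  word_eval b (s ++ s') = word_eval b s + word_eval b s'.
Proof. exact: big_cat. Qed.

Lemma word_eval_scale P (b : N -> M -> P) a s :
  is_bilin b -> word_eval b (word_scale a s) = a *: word_eval b s.
Proof.
move=> bb; rewrite /word_eval big_map scaler_sumr.
by apply: eq_bigr => p _ /=; rewrite bilinZl.
Qed.

Let tensor_setoid : semimod_setoid A.
Proof.
refine (@SemimodSetoid A (seq (N * M)) word_sim [::] (@seq.cat _) word_scale
  _ _ _ _ _ _ _ _ _ _ _ _ _).
- by [].
- by move=> s s' E P b bb; rewrite E.
- by move=> s s' s'' E E' P b bb; rewrite E // E'.
- by move=> s s' r r' E E' P b bb; rewrite !word_eval_cat E // E'.
- by move=> a s s' E P b bb; rewrite !word_eval_scale // E.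
- by move=> s s' s'' P b bb; rewrite catA.
- by move=> s s' P b bb; rewrite !word_eval_cat addrC.
- by [].
- by move=> a b s P c cb; rewrite !word_eval_scale // scalerA.
- by move=> s P b bb; rewrite word_eval_scale // scale0r /word_eval big_nil.
- by move=> s P b bb; rewrite word_eval_scale // scale1r.
- move=> a s s' P b bb.
  by rewrite word_eval_cat !word_eval_scale // word_eval_cat scalerDr.
- by move=> s a b P c cb; rewrite word_eval_cat !word_eval_scale // scalerDl.
Defined.

Lemma tensor_exists : exists T (t : N -> M -> T),
  is_tensor t /\ forall z, exists s, z = \sum_(p <- s) t p.1 p.2.
Proof.
pose pi : seq (N * M) -> quot tensor_setoid := @quot_pi A tensor_setoid.
pose t n m := pi [:: (n, m)].
have piE s s' : pi s = pi s' <-> word_sim s s' by exact: quot_eqP.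
have pi0 : pi [::] = 0 by [].
have piD s s' : pi (s ++ s') = pi s + pi s' by exact: quot_piD.
have piZ a s : pi (word_scale a s) = a *: pi s by exact: quot_piZ.
have pi_sum s : pi s = \sum_(p <- s) t p.1 p.2.
  elim: s => [|[n m] s IH]; first by rewrite big_nil.
  by rewrite big_cons -cat1s piD IH.
have zE z : exists s, z = \sum_(p <- s) t p.1 p.2.
  by exists (quot_repr z); rewrite -pi_sum /pi quot_piK.
have tb : is_bilin t.
  split=> [m|n]; split=> [|x y|a x].
  - rewrite -pi0; apply/piE => P b bb.
    by rewrite /word_eval big_seq1 big_nil /= bilin0l.
  - by rewrite -piD; apply/piE => P b bb;
      rewrite word_eval_cat /word_eval !big_seq1 /= bilinDl.
  - by rewrite -piZ; apply/piE => P b bb; rewrite word_eval_scale // /word_eval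
      !big_seq1 /= bilinZl.
  - rewrite -pi0; apply/piE => P b bb.
    by rewrite /word_eval big_seq1 big_nil /= bilin0r.
  - by rewrite -piD; apply/piE => P b bb;
      rewrite word_eval_cat /word_eval !big_seq1 /= bilinDr.
  - by rewrite -piZ; apply/piE => P b bb; rewrite word_eval_scale // /word_eval
      !big_seq1 /= bilinZr.
exists (quot tensor_setoid), t; split=> //; split=> // P b bb.
pose phi (z : quot tensor_setoid) := word_eval b (quot_repr z).
have phiE s : phi (pi s) = word_eval b s.
  have h : word_sim (quot_repr (pi s)) s := quot_reprK (s : tensor_setoid).
  exact: h.
have piS z : exists s, z = pi s by exists (quot_repr z); rewrite /pi quot_piK.
exists phi; split.
- split=> [|x y|a x].
  + by rewrite -pi0 phiE /word_eval big_nil.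
  + have [[s ->] [s' ->]] := (piS x, piS y).
    by rewrite -piD !phiE word_eval_cat.
  + by have [s ->] := piS x; rewrite -piZ !phiE word_eval_scale.
- by move=> n m; rewrite /t phiE /word_eval big_seq1.
- move=> psi psiL psiE z; have [s ->] := piS z.
  rewrite phiE pi_sum (lin_sum _ _ psiL).
  by apply: eq_bigr.
Qed.

End Construction.

(** In the model by words this holds by construction, and the comparison maps between two tensor
    products carry it over to [T]. *)
Lemma tensor_sum N M T (t : N -> M -> T) :
  is_tensor t -> forall z, exists s, z = \sum_(p <- s) t p.1 p.2.
Proof.
move=> tT z; have [tb tU] := tT.
have [T0 [t0 [[t0b t0U] t0S]]] := tensor_exists N M.
have [f [fL fE _]] := tU _ _ t0b.
have [g [gL gE _]] := t0U _ _ tb.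
have [s sE] := t0S (f z); exists s.
have -> : z = g (f z).
  apply: (tensor_ext tT (f := id) (g := fun x => g (f x))) => //.
    exact: lin_comp.
  by move=> n m; rewrite fE gE.
rewrite sE (lin_sum _ _ gL).
by apply: eq_bigr => p _.
Qed.

End Tensor.

(** * The module Hom(M, P) and preservation of colimits *)

Section HomModule.
Variables (A : comPzSemiRingType) (M P : lSemiModType A).

Let lin_map := {f : M -> P | is_lin f}.

Lemma lin_zero : is_lin (fun _ : M => 0 : P).
Proof. by split=> *; rewrite ?addr0 ?scaler0. Qed.

Lemma lin_add (f g : M -> P) : is_lin f -> is_lin g -> is_lin (fun x => f x + g x).
Proof.
move=> fL gL; split=> [|x y|a x].
- by rewrite (lin0 fL) (lin0 gL) addr0.
- by rewrite (linD fL) (linD gL) addrACA.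
- by rewrite (linZ fL) (linZ gL) scalerDr.
Qed.

Lemma lin_scale a (f : M -> P) : is_lin f -> is_lin (fun x => a *: f x).
Proof.
move=> fL; split=> [|x y|b x].
- by rewrite (lin0 fL) scaler0.
- by rewrite (linD fL) scalerDr.
- by rewrite (linZ fL) !scalerA mulrC.
Qed.

Definition hom_setoid : semimod_setoid A.
Proof.
refine (@SemimodSetoid A lin_map (fun f g => sval f =1 sval g)
  (exist _ _ lin_zero) (fun f g => exist _ _ (lin_add (svalP f) (svalP g)))
  (fun a f => exist _ _ (lin_scale a (svalP f))) _ _ _ _ _ _ _ _ _ _ _ _ _).
- by [].
- by move=> f g E x; rewrite E.
- by move=> f g h E E' x; rewrite E E'.
- by move=> f f' g g' E E' x /=; rewrite E E'.
- by move=> a f f' E x /=; rewrite E.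
- by move=> f g h x /=; rewrite addrA.
- by move=> f g x /=; rewrite addrC.
- by move=> f x /=; rewrite add0r.
- by move=> a b f x /=; rewrite scalerA.
- by move=> f x /=; rewrite scale0r.
- by move=> f x /=; rewrite scale1r.
- by move=> a f g x /=; rewrite scalerDr.
- by move=> f a b x /=; rewrite scalerDl.
Defined.

Definition hom_mod : lSemiModType A := quot hom_setoid.
Definition hom_of (f : M -> P) (fL : is_lin f) : hom_mod :=
  quot_pi (exist _ f fL : hom_setoid).
Definition hom_ev (q : hom_mod) : M -> P :=
  sval (quot_repr (q : quot hom_setoid) : lin_map).

Lemma hom_ofK f (fL : is_lin f) : hom_ev (hom_of fL) =1 f.
Proof. exact: (quot_reprK (exist _ f fL : hom_setoid)). Qed.

Lemma hom_ev_lin q : is_lin (hom_ev q).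
Proof. exact: svalP (quot_repr (q : quot hom_setoid) : lin_map). Qed.

Lemma hom_ext (q r : hom_mod) : hom_ev q =1 hom_ev r -> q = r.
Proof.
by move=> E; rewrite -[q]quot_piK -[r]quot_piK; apply/quot_eqP.
Qed.

Lemma hom_ev_linl m : is_lin (fun q => hom_ev q m).
Proof.
have reprK := quot_reprK (S := hom_setoid).
split=> [|q r|a q]; [exact: (reprK (szero hom_setoid)) | | ].
  rewrite -[q in LHS](@quot_piK _ hom_setoid) -[r in LHS](@quot_piK _ hom_setoid).
  by rewrite -quot_piD; apply: reprK.
rewrite -[q in LHS](@quot_piK _ hom_setoid) -quot_piZ; exact: reprK.
Qed.

End HomModule.
Arguments hom_ev_linl {A M P} m.

(** A cocone with vertex P under the tensored diagram is curried into a cocone [g] under D with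
    vertex Hom(M, P). Its mediating map [u], uncurried, is bilinear and hence factors through the
    tensor product of the colimit. *)
Lemma tensor_preserves_colimits (A : comPzSemiRingType) (M : lSemiModType A) :
  tensor_preserves_finite_colimits M.
Proof.
move=> C _ D L iota [[iL iC] iU] E t [tT tE] TL tL tLT kap kapL kapE.
have [tLb tLU] := tLT.
have kC : is_cocone E kap.
  split=> // a b f; apply: (tensor_ext (tT a)) => //.
    exact: lin_comp (kapL b) (dmap_lin E f).
  by move=> n m; rewrite tE !kapE iC.
split=> // P iota' [i'L i'C].
have gL j x : is_lin (fun m => iota' j (t j x m)).
  by apply: (lin_comp (i'L j)); exact: (tT j).1.2.
pose g j x : hom_mod M P := hom_of (gL j x).
have gC : is_cocone D g.
  split=> [j|a b f x].
    have tb := (tT j).1.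
    split=> [|x y|a x]; apply: hom_ext => m.
    - by rewrite hom_ofK (lin0 (hom_ev_linl m)) (bilin0l _ tb) (lin0 (i'L j)).
    - by rewrite (linD (hom_ev_linl m)) !hom_ofK (bilinDl _ tb) (linD (i'L j)).
    - by rewrite (linZ (hom_ev_linl m)) !hom_ofK (bilinZl _ _ _ tb) (linZ (i'L j)).
  by apply: hom_ext => m; rewrite !hom_ofK -tE i'C.
have [u [uL uE uU]] := iU _ g gC.
have [|phi [phiL phiE phiU]] := tLU P (fun x m => hom_ev (u x) m).
  split=> [m|x]; last exact: hom_ev_lin.
  exact: (lin_comp (hom_ev_linl m)).
exists phi; split=> //.
  move=> j; apply: (tensor_ext (tT j)) => //; first exact: lin_comp.
  by move=> x m; rewrite kapE phiE uE hom_ofK.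
move=> v vL vE; apply: (tensor_ext tLT) => // x m; rewrite phiE.
(* For uniqueness the competitor [v] is curried too, and compared with [u]. *)
have hL y : is_lin (fun m => v (tL y m)).
  by apply: (lin_comp vL); exact: tLb.2.
rewrite -(uU (fun y => hom_of (hL y))) ?hom_ofK //.
  split=> [|y z|a y]; apply: hom_ext => m'.
  - by rewrite hom_ofK (lin0 (hom_ev_linl m')) (bilin0l _ tLb) (lin0 vL).
  - by rewrite (linD (hom_ev_linl m')) !hom_ofK (bilinDl _ tLb) (linD vL).
  - by rewrite (linZ (hom_ev_linl m')) !hom_ofK (bilinZl _ _ _ tLb) (linZ vL).
by move=> j y; apply: hom_ext => m'; rewrite !hom_ofK -kapE vE.
Qed.

(** * Tensoring with a filtered colimit of finite free modules *)

Section MatrixAction.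
Variable A : comPzSemiRingType.
Implicit Types N : lSemiModType A.

(** The family is treated as a row with entries in N, multiplied by the matrix on the right. This is
    N (x) U from N^n to N^p, hence covariant for the product of matrices in diagrammatic order. *)
Definition mx_act N n p (U : 'M[A]_(n, p)) (y : {ffun 'I_n -> N}) :
  {ffun 'I_p -> N} := [ffun l => \sum_k U k l *: y k].

Lemma mx_act_lin N n p (U : 'M[A]_(n, p)) : is_lin (@mx_act N n p U).
Proof.
split=> [|x y|a x]; apply/ffunP => l; rewrite !ffunE.
- by apply: big1 => k _; rewrite ffunE scaler0.
- by rewrite -big_split; apply: eq_bigr => k _; rewrite ffunE scalerDr.
- rewrite scaler_sumr; apply: eq_bigr => k _.
  by rewrite ffunE !scalerA mulrC.
Qed.

Lemma mx_act1 N n (y : {ffun 'I_n -> N}) : mx_act 1%:M y = y.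
Proof.
apply/ffunP => l; rewrite ffunE (bigD1 l) //= big1 ?addr0.
  by rewrite mxE eqxx scale1r.
by move=> k kl; rewrite mxE (negbTE kl) scale0r.
Qed.

Lemma mx_actM N n p q (U : 'M[A]_(n, p)) (V : 'M[A]_(p, q)) (y : {ffun 'I_n -> N}) :
  mx_act (U *m V) y = mx_act V (mx_act U y).
Proof.
apply/ffunP => l; rewrite !ffunE.
under eq_bigr do rewrite mxE scaler_suml.
rewrite exchange_big; apply: eq_bigr => k _; rewrite ffunE scaler_sumr.
by apply: eq_bigr => j _; rewrite scalerA mulrC.
Qed.

Lemma mx_act_nat N N' (h : N -> N') n p (U : 'M[A]_(n, p)) (y : {ffun 'I_n -> N}) :
  is_lin h -> mx_act U [ffun k => h (y k)] = [ffun l => h (mx_act U y l)].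
Proof.
move=> hL; apply/ffunP => l; rewrite !ffunE (lin_sum _ _ hL).
by apply: eq_bigr => k _; rewrite ffunE (linZ hL).
Qed.

Lemma lin_mx n N (h : 'rV[A]_n -> N) v :
  is_lin h -> h v = \sum_k v 0 k *: h (delta_mx 0 k).
Proof.
move=> hL; rewrite [v in LHS]row_sum_delta (lin_sum _ _ hL).
by apply: eq_bigr => k _; rewrite (linZ hL).
Qed.

End MatrixAction.

(** * Representing tensors and their equality at a stage *)

Section Stages.
Variables (A : comPzSemiRingType) (M : lSemiModType A).
Variables (I : cat) (F : diagram A I) (iota : forall i : I, dob F i -> M).
Arguments iota : clear implicits.
Hypotheses (hI : filtered I) (colim : is_colimit F iota).
Variables (n : I -> nat) (phi : forall i, 'rV[A]_(n i) -> dob F i).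
Variable psi : forall i, dob F i -> 'rV[A]_(n i).
Hypotheses (phiL : forall i, is_lin (@phi i)).
Hypotheses (phiK : forall i, cancel (@phi i) (@psi i)).
Hypotheses (psiK : forall i, cancel (@psi i) (@phi i)).
Implicit Types N T : lSemiModType A.

Let psiL i : is_lin (@psi i).
Proof. exact: lin_inv (phiL i) (@phiK i) (@psiK i). Qed.

Let trans a b (f : Hom a b) : 'M[A]_(n a, n b) :=
  \matrix_k psi (dmap F f (phi (delta_mx 0 k))).

Lemma transE a b (f : Hom a b) v : psi (dmap F f (phi v)) = v *m trans f.
Proof.
rewrite (@lin_mx _ _ _ (fun v => psi (dmap F f (phi v)))); last first.
  exact: (lin_comp (psiL b) (lin_comp (dmap_lin F f) (phiL a))).
by rewrite mulmx_sum_row; apply: eq_bigr => k _; rewrite rowK.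
Qed.

Lemma trans_id a : trans (idc a) = 1%:M.
Proof. by apply/row_matrixP => k; rewrite rowK dmap_id phiK row1. Qed.

Lemma trans_comp a b c (g : Hom b c) (f : Hom a b) :
  trans (comp g f) = trans f *m trans g.
Proof.
apply/row_matrixP => k; rewrite row_mul !rowK -transE psiK.
by rewrite dmap_comp.
Qed.

Let gen i (k : 'I_(n i)) : M := iota i (phi (delta_mx 0 k)).
Arguments gen : clear implicits.

Lemma iota_gen i x : iota i x = \sum_k psi x 0 k *: gen i k.
Proof.
rewrite -{1}(psiK x) (@lin_mx _ _ _ (fun v => iota i (phi v))) //.
exact: (lin_comp (colim.1.1 i) (phiL i)).
Qed.

Lemma gen_trans a b (f : Hom a b) k : gen a k = \sum_l trans f k l *: gen b l.
Proof.
rewrite /gen -(colim.1.2 _ _ f) iota_gen; apply: eq_bigr => l _.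
by rewrite mxE.
Qed.

(** The diagram N (x) F in coordinates, with N (x) A^(n i) written as N^(n i). *)
Let pow N : diagram A I.
Proof.
refine (@Diagram A I (fun i => {ffun 'I_(n i) -> N} : lSemiModType A)
  (fun a b f => mx_act (trans f)) _ _ _).
- by move=> a b f; exact: mx_act_lin.
- by move=> a x; rewrite trans_id mx_act1.
- by move=> a b c g f x; rewrite trans_comp mx_actM.
Defined.

(** The canonical map N (x) [iota i] from N^(n i) to N (x) M; the lemmas below show that these maps
    form a cocone, natural in N, that is jointly surjective and injective up to passing to a later
    stage. *)
Let tau N T (t : N -> M -> T) i (y : {ffun 'I_(n i) -> N}) : T :=
  \sum_k t (y k) (gen i k).

Lemma tau_act N T (t : N -> M -> T) a b (f : Hom a b) y :
  is_bilin t -> tau t (mx_act (trans f) y) = tau t y.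
Proof.
move=> tb; rewrite /tau.
under eq_bigr do rewrite ffunE (lin_sum _ _ (tb.1 _)).
rewrite exchange_big; apply: eq_bigr => k _.
rewrite (gen_trans f) (lin_sum _ _ (tb.2 _)).
by apply: eq_bigr => l _; rewrite (linZ (tb.1 _)) (linZ (tb.2 _)).
Qed.

Lemma tau_nat N N' T T' (t : N -> M -> T) (t' : N' -> M -> T') h g i
    (y : {ffun 'I_(n i) -> N}) :
  is_lin g -> (forall x m, g (t x m) = t' (h x) m) ->
  g (tau t y) = tau t' [ffun k => h (y k)].
Proof.
move=> gL gE; rewrite /tau (lin_sum _ _ gL).
by apply: eq_bigr => k _; rewrite ffunE gE.
Qed.

(** A pure tensor is represented at any stage where its factor in M lives, by the coordinates of
    that factor times x. Finite sums are added after moving both summands to a common stage. *)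
Lemma tau_surj N T (t : N -> M -> T) :
  is_tensor t -> forall z, exists i (y : {ffun 'I_(n i) -> N}), z = tau t y.
Proof.
move=> tT z; have tb := tT.1; have [s ->] := tensor_sum tT z.
elim: s => [|[x m] s [i [y yE]]].
  have [[i] _ _] := hI; exists i, 0.
  rewrite big_nil /tau big1 // => k _.
  by rewrite ffunE bilin0l.
rewrite big_cons yE /=.
have [j [v ->]] := filtered_colimit_surj hI colim m.
have -> : t x (iota j v) = tau t [ffun k => psi v 0 k *: x].
  rewrite iota_gen (lin_sum _ _ (tb.2 _)); apply: eq_bigr => k _.
  by rewrite ffunE bilinZl // bilinZr.
have [k [f [g _]]] := filtered_ub2 hI j i.
rewrite -(tau_act f _ tb) -(tau_act g _ tb) /tau.
move: (mx_act _ _) (mx_act _ _) => y2 y1.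
exists k, (y1 + y2); rewrite -big_split; apply: eq_bigr => l _ /=.
by rewrite ffunE bilinDl.
Qed.

(* N (x) M maps to the explicit filtered colimit of the N^(n i), where equality
   is decided at some stage. *)
Lemma tau_inj N T (t : N -> M -> T) i (y y' : {ffun 'I_(n i) -> N}) :
  is_tensor t -> tau t y = tau t y' ->
  exists k (f : Hom i k), mx_act (trans f) y = mx_act (trans f) y'.
Proof.
move=> [tb tU] E.
have [Q [kap [[[kapL kapC] _] _ kapE]]] := filtered_colimit_exists hI (pow N).
have msurj := filtered_colimit_surj hI colim.
(* For fixed x this is the cocone sending v to the class of x (x) v. The induced maps out of M
   assemble into a bilinear map [u], hence a linear [w] from N (x) M to [Q] with [w] after [tau]
   equal to [kap]. *)
pose g x j (v : dob F j) : Q := kap j [ffun k => psi v 0 k *: x].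
have gC x : is_cocone F (g x).
  split=> [j|a b f v].
    apply: (lin_comp (kapL j)); split=> [|v w|a v]; apply/ffunP => k; rewrite !ffunE.
    - by rewrite (lin0 (psiL j)) mxE scale0r.
    - by rewrite (linD (psiL j)) mxE scalerDl.
    - by rewrite (linZ (psiL j)) mxE scalerA.
  rewrite /g -(kapC _ _ f); congr (kap b _); apply/ffunP => l; rewrite !ffunE.
  rewrite -{1}(psiK v) transE mxE scaler_suml.
  by apply: eq_bigr => k _; rewrite ffunE scalerA mulrC.
have /choice[u uP] x : exists u : M -> Q,
    is_lin u /\ forall j v, u (iota j v) = g x j v.
  by have [u [uL uE _]] := colim.2 Q (g x) (gC x); exists u.
have ub : is_bilin u.
  split=> [m|x]; last exact: (uP x).1.
  have [j [v ->]] := msurj m.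
  split=> [|x x'|a x]; rewrite !(uP _).2 /g.
  - rewrite -(lin0 (kapL j)); congr (kap j _); apply/ffunP => k.
    by rewrite !ffunE scaler0.
  - rewrite -(linD (kapL j)); congr (kap j _); apply/ffunP => k.
    by rewrite !ffunE scalerDr.
  - rewrite -(linZ (kapL j)); congr (kap j _); apply/ffunP => k.
    by rewrite !ffunE !scalerA mulrC.
have [w [wL wE _]] := tU Q u ub.
have wtau (z : {ffun 'I_(n i) -> N}) : w (tau t z) = kap i z.
  rewrite /tau (lin_sum _ _ wL).
  under eq_bigr do rewrite wE (uP _).2.
  rewrite -(lin_sum _ _ (kapL i)); congr (kap i _); apply/ffunP => l.
  rewrite sum_ffunE (bigD1 l) //= big1 => [|k kl].
    by rewrite ffunE phiK mxE !eqxx scale1r addr0.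
  by rewrite ffunE phiK mxE eqxx eq_sym (negbTE kl) scale0r.
have [k [f fE]] : exists k (f : Hom i k), dmap (pow N) f y = dmap (pow N) f y'.
  by apply: kapE; rewrite -!wtau E.
by exists k, f.
Qed.

Lemma stages_preserve_limits : tensor_preserves_finite_limits M.
Proof.
move=> C [[obs obsP] homs] D L pi /is_limitP[[piL piC] piU] E t [tT tE] TL tL tLT.
move=> rho rhoL rhoE.
have tb j := (tT j).1; have tLb := tLT.1.
have piI l l' : (forall j, pi j l = pi j l') -> l = l'.
  move=> e; have [|k [_ kU]] := piU (fun j => pi j l').
    by move=> a b f; exact: piC.
  by rewrite -(kU l) // -(kU l').
have rtau j i (y : {ffun 'I_(n i) -> L}) :
    rho j (tau tL y) = tau (t j) [ffun k => pi j (y k)].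
  by apply: tau_nat.
apply/is_limitP; split.
  split=> // a b f; apply: (tensor_ext tLT) => //.
    exact: lin_comp (dmap_lin E f) (rhoL a).
  by move=> x m; rewrite !rhoE tE piC.
move=> z zC.
(* First, one stage carries representatives of all components of the compatible family [z]. *)
have [i [y yE]] : exists i (y : forall j, {ffun 'I_(n i) -> dob D j}),
    forall j, z j = tau (t j) (y j).
  have [[i0] _ _] := hI.
  have [||i [_ iP]] := @filtered_seq I hI i0 C obs
    (fun j i _ => exists y : {ffun 'I_(n i) -> dob D j}, z j = tau (t j) y).
  - by move=> j a _ b g [y ->]; exists (mx_act (trans g) y); rewrite tau_act.
  - move=> j; have [a [y ->]] := tau_surj (tT j) (z j).
    have [k [f [g _]]] := filtered_ub2 hI i0 a; exists k, f.
    by exists (mx_act (trans g) y); rewrite tau_act.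
  exists i; pose y j := sval (cid (iP j (obsP j))).
  by exists y => j; exact: (svalP (cid (iP j (obsP j)))).
(* The representatives are compatible only after applying [tau]; each arrow of the shape becomes an
   exact equation at a later stage by [tau_inj], and one stage serves all arrows. *)
have [i' [y' [y'E y'C]]] : exists i' (y' : forall j, {ffun 'I_(n i') -> dob D j}),
    (forall j, z j = tau (t j) (y' j)) /\
    (forall a b (f : Hom a b), [ffun k => dmap D f (y' a k)] = y' b).
  pose hs (p : C * C) := sval (cid (homs p.1 p.2)).
  have hsP p f : List.In f (hs p) := svalP (cid (homs p.1 p.2)) f.
  pose arrow := {p : C * C & Hom p.1 p.2}.
  pose arrows : seq arrow := List.flat_map (fun p => List.map (existT _ p) (hs p))
    (List.list_prod obs obs).
  have arrowsP (f : arrow) : List.In f arrows.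
    case: f => [[a b] f]; apply/List.in_flat_map; exists (a, b); split.
      exact: List.in_prod.
    exact/List.in_map/hsP.
  have [||k [g gP]] := @filtered_seq I hI i arrow arrows (fun f k g =>
    mx_act (trans g) [ffun l => dmap D (projT2 f) (y (projT1 f).1 l)] =
    mx_act (trans g) (y (projT1 f).2)).
  - by move=> f j g k h e; rewrite trans_comp !mx_actM e.
  - move=> [[a b] f] /=; apply: tau_inj (tT b) _.
    rewrite -yE -(zC _ _ f) yE; symmetry; apply: tau_nat; first exact: dmap_lin.
    exact: tE.
  exists k, (fun j => mx_act (trans g) (y j)); split=> [j|a b f].
    by rewrite tau_act.
  have := gP (existT _ (a, b) f) (arrowsP _) => /= <-.
  by rewrite mx_act_nat //; exact: dmap_lin.
(* Now each coordinate is a compatible family in D, so it comes from the limit [L]. *)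
have /choice[x xE] (k : 'I_(n i')) : exists l, forall j, pi j l = y' j k.
  have [|l [lE _]] := piU (fun j => y' j k).
    by move=> a b f; rewrite -(y'C a b f) ffunE.
  by exists l.
exists (tau tL [ffun k => x k]); split=> [j|w wE].
  rewrite rtau y'E; congr tau; apply/ffunP => k.
  by rewrite !ffunE xE.
(* Uniqueness: the competitor and the constructed element are represented at a common stage. All
   their projections agree at a later one, and there the representatives coincide because the [pi j]
   are jointly injective. *)
have [a [v vE]] := tau_surj tLT w.
have [k [f [g _]]] := filtered_ub2 hI i' a.
rewrite vE -(tau_act f _ tLb) -(tau_act g _ tLb).
set v1 := mx_act _ _; set v2 := mx_act _ _.
have [||k' [h hP]] := @filtered_seq I hI k C obs (fun j k' h =>
    mx_act (trans h) [ffun l => pi j (v1 l)] =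
    mx_act (trans h) [ffun l => pi j (v2 l)]).
- by move=> j b h c h' e; rewrite trans_comp !mx_actM e.
- move=> j; apply: tau_inj (tT j) _; rewrite -!rtau !tau_act // -vE wE rtau y'E.
  by congr tau; apply/ffunP => l; rewrite !ffunE xE.
rewrite -(tau_act h v1 tLb) -(tau_act h v2 tLb); congr tau; apply/ffunP => l.
apply: piI => j; move/ffunP/(_ l): (hP j (obsP j)).
by rewrite !mx_act_nat // !ffunE.
Qed.

End Stages.

Lemma filtered_colimit_of_finite_free_flat (A : comPzSemiRingType)
    (M : lSemiModType A) :
  filtered_colimit_of_finite_free M -> flat M.
Proof.
move=> [I [F [iota [hI free colim]]]]; split; last exact: tensor_preserves_colimits.
pose coords i := {n : nat & (('rV[A]_n -> dob F i) * (dob F i -> 'rV[A]_n))%type}.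
pose good i (s : coords i) :=
  [/\ is_lin (projT2 s).1, cancel (projT2 s).1 (projT2 s).2
    & cancel (projT2 s).2 (projT2 s).1].
have ex i : exists s, good i s.
  by have [n [f [fL [g fK gK]]]] := free i; exists (existT _ n (f, g)).
pose s i := sval (cid (ex i)); have sP i : good i (s i) := svalP (cid (ex i)).
apply: (stages_preserve_limits hI colim (phi := fun i => (projT2 (s i)).1)
  (psi := fun i => (projT2 (s i)).2)) => i; by case: (sP i).
Qed.

(** * Equalizers *)

(** The shape of a parallel pair: [false] is the source, [true] the target, and the two booleans are
    the two parallel arrows. *)
Definition par_hom (a b : bool) : Set :=
  match a, b with
  | false, true => bool
  | true, false => void
  | _, _ => unit
  end.

Definition par_id (a : bool) : par_hom a a := if a return par_hom a a then tt else tt.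

Definition par_comp (a b c : bool) : par_hom b c -> par_hom a b -> par_hom a c :=
  match a, b, c return par_hom b c -> par_hom a b -> par_hom a c with
  | false, false, false | true, true, true => fun _ _ => tt
  | false, false, true => fun h _ => h
  | false, true, true => fun _ h => h
  | false, true, false => fun h _ => match h with end
  | true, false, false | true, false, true => fun _ h => match h with end
  | true, true, false => fun h _ => h
  end.

Definition par_cat : cat.
Proof.
refine (@Cat bool par_hom par_id par_comp _ _ _).
- by case=> [] [] //= [].
- by case=> [] [] //= [].
- by case=> [] [] [] [] //= [] // [].
Defined.

Lemma par_cat_finite : finite_cat par_cat.
Proof.
split; first by exists [:: false; true] => -[]; [right; left | left].
case=> [] []; [exists [:: tt] | exists [::] | exists [:: false; true] | exists [:: tt]].
- by case; left.
- by case.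
- by case; [right; left | left].
- by case; left.
Qed.

Section Equalizer.
Variables (A : comPzSemiRingType) (X Y : lSemiModType A) (f g : X -> Y).
Hypotheses (fL : is_lin f) (gL : is_lin g).

Definition par_ob (a : bool) : lSemiModType A := if a then Y else X.

Definition par_map (a b : bool) : par_hom a b -> par_ob a -> par_ob b :=
  match a, b return par_hom a b -> par_ob a -> par_ob b with
  | false, true => fun h => if h then f else g
  | true, false => fun h => match h with end
  | false, false | true, true => fun _ x => x
  end.

Definition par_diagram : diagram A par_cat.
Proof.
refine (@Diagram A par_cat par_ob par_map _ _ _).
- by case=> [] [] //= [] //; exact: lin_id.
- by case.
- by case=> [] [] [] //= [] // [].
Defined.

Let eqz := {x : X | f x = g x}.

Lemma eqz0 : f 0 = g 0.
Proof. by rewrite (lin0 fL) (lin0 gL). Qed.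

Lemma eqzD (x y : eqz) : f (sval x + sval y) = g (sval x + sval y).
Proof. by rewrite (linD fL) (linD gL) (svalP x) (svalP y). Qed.

Lemma eqzZ a (x : eqz) : f (a *: sval x) = g (a *: sval x).
Proof. by rewrite (linZ fL) (linZ gL) (svalP x). Qed.

Let eqz_setoid : semimod_setoid A.
Proof.
refine (@SemimodSetoid A eqz (fun x y => sval x = sval y) (exist _ _ eqz0)
  (fun x y => exist _ _ (eqzD x y)) (fun a x => exist _ _ (eqzZ a x))
  _ _ _ _ _ _ _ _ _ _ _ _ _) => //=.
- by move=> x y z -> ->.
- by move=> x x' y y' -> ->.
- by move=> a x x' ->.
- by move=> x y z; rewrite addrA.
- by move=> x y; rewrite addrC.
- by move=> x; rewrite add0r.
- by move=> a b x; rewrite scalerA.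
- by move=> x; rewrite scale0r.
- by move=> x; rewrite scale1r.
- by move=> a x y; rewrite scalerDr.
- by move=> x a b; rewrite scalerDl.
Defined.

Lemma equalizer_exists : exists (L : lSemiModType A) (e : L -> X),
  [/\ is_lin e, injective e, (forall l, f (e l) = g (e l))
    & forall x, f x = g x -> exists l, e l = x].
Proof.
pose e (q : quot eqz_setoid) := sval (quot_repr q : eqz).
have eE (x : eqz_setoid) : e (quot_pi x) = sval (x : eqz) by exact: (quot_reprK x).
exists (quot eqz_setoid), e; split.
- split=> [|p q|a q]; first by rewrite -quot_pi0 eE.
    by rewrite -(quot_piK p) -(quot_piK q) -quot_piD !eE.
  by rewrite -(quot_piK q) -quot_piZ !eE.
- by move=> p q E; rewrite -(quot_piK p) -(quot_piK q); apply/quot_eqP.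
- by move=> l; exact: (svalP (quot_repr l : eqz)).
- by move=> x xP; exists (quot_pi (exist _ x xP : eqz_setoid)); rewrite eE.
Qed.

Lemma equalizer_is_limit (L : lSemiModType A) (pi : forall j, L -> dob par_diagram j) :
  is_cone par_diagram pi -> injective (pi false) ->
  (forall x, f x = g x -> exists l, pi false l = x) -> is_limit par_diagram pi.
Proof.
move=> piC piI piS; apply/is_limitP; split=> // x xC.
have xf : f (x false) = x true := xC false true true.
have xg : g (x false) = x true := xC false true false.
have [|l lE] := piS (x false); first by rewrite xf.
exists l; split=> [[]|l' l'E]; last by apply: piI; rewrite lE l'E.
  by rewrite -xf -lE; have := piC.2 false true true l => /= ->.
exact: lE.
Qed.

Lemma equalizer_limitE (L : lSemiModType A) (pi : forall j, L -> dob par_diagram j) :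
  is_limit par_diagram pi -> forall x, f x = g x -> exists l, pi false l = x.
Proof.
move=> /is_limitP[_ U] x xE.
pose fam j : dob par_diagram j := if j return par_ob j then f x else x.
have [|l [lE _]] := U fam; first by case=> [] [] // [].
by exists l; exact: (lE false).
Qed.

End Equalizer.

(** Flatness speaks of arbitrary tensor products; this one allows M^m to stand for A^m (x) M. A
    bilinear map is determined by its values on the basis vectors, which gives the factorization
    [phi]. *)
Lemma free_tensor (A : comPzSemiRingType) (M : lSemiModType A) m :
  is_tensor (fun (c : 'cV[A]_m) (x : M) => [ffun l => c l 0 *: x] : {ffun 'I_m -> M}).
Proof.
split.
  split=> [x|c]; split=> [|a b|a b]; apply/ffunP => l; rewrite !ffunE ?mxE.
  - by rewrite scale0r.
  - by rewrite scalerDl.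
  - by rewrite scalerA.
  - by rewrite scaler0.
  - by rewrite scalerDr.
  - by rewrite !scalerA mulrC.
move=> P b bb.
pose phi (x : {ffun 'I_m -> M}) := \sum_l b (delta_mx l 0) (x l).
have phiL : is_lin phi.
  split=> [|x y|a x]; rewrite /phi.
  - by apply: big1 => l _; rewrite ffunE bilin0r.
  - by rewrite -big_split; apply: eq_bigr => l _; rewrite ffunE bilinDr.
  - by rewrite scaler_sumr; apply: eq_bigr => l _; rewrite ffunE bilinZr.
have cE (c : 'cV[A]_m) : c = \sum_l c l 0 *: delta_mx l 0.
  apply/matrixP => i j; rewrite ord1 summxE (bigD1 i) //= big1 => [|l li].
    by rewrite !mxE !eqxx mulr1 addr0.
  by rewrite !mxE eq_sym (negbTE li) mulr0.
exists phi; split=> //.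
  move=> c x; rewrite [c in RHS]cE (lin_sum _ _ (bb.1 x)).
  by apply: eq_bigr => l _; rewrite ffunE bilinZl // bilinZr.
move=> psi psiL psiE x.
have xE : x = \sum_l [ffun l' => (delta_mx l 0 : 'cV[A]_m) l' 0 *: x l].
  apply/ffunP => i; rewrite sum_ffunE (bigD1 i) //= big1 => [|l li].
    by rewrite ffunE mxE !eqxx scale1r addr0.
  by rewrite ffunE mxE eq_sym (negbTE li) scale0r.
rewrite [x in LHS]xE (lin_sum _ _ psiL).
by apply: eq_bigr.
Qed.

(** * Flat modules *)

(* The equational criterion: tensor the equalizer of [u, v : A^m -> A^n] with M,
   and read off [y] as a finite sum of tensors. *)
Lemma flat_equational (A : comPzSemiRingType) (M : lSemiModType A) n m
    (u v : 'M[A]_(n, m)) (y : {ffun 'I_m -> M}) :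
  tensor_preserves_finite_limits M ->
  mx_act u^T y = mx_act v^T y ->
  exists p (w : 'M[A]_(m, p)) (z : {ffun 'I_p -> M}),
    u *m w = v *m w /\ y = mx_act w^T z.
Proof.
move=> flatM yE.
pose f (U : 'M[A]_(n, m)) (c : 'cV[A]_m) : 'cV[A]_n := U *m c.
have fL U : is_lin (f U).
  split=> [|x x'|a x]; first exact: mulmx0.
    exact: mulmxDr.
  by rewrite /f -scalemxAr.
have [L [e [eL eI eC eS]]] := equalizer_exists (fL u) (fL v).
have [TL [tL [tLT tLS]]] := tensor_exists L M.
pose t k (c : 'cV[A]_k) (x : M) : {ffun 'I_k -> M} := [ffun l => c l 0 *: x].
have tT k : is_tensor (@t k) by exact: free_tensor.
(* Under A^k (x) M = M^k, multiplication of columns by U becomes the action of [U^T], so the pair of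
   actions on M^m is the tensored parallel pair. *)
have tact (U : 'M[A]_(n, m)) c x : mx_act U^T (t m c x) = t n (f U c) x.
  apply/ffunP => k; rewrite !ffunE mxE scaler_suml.
  by apply: eq_bigr => l _; rewrite ffunE mxE scalerA.
have [|r [rL rE _]] := tLT.2 _ (fun x a => t m (e x) a).
  split=> [a|x]; last exact: (tT m).1.2.
  exact: (lin_comp ((tT m).1.1 a)).
pose D := par_diagram (fL u) (fL v).
pose E := par_diagram (@mx_act_lin A M _ _ u^T) (@mx_act_lin A M _ _ v^T).
pose pi j : L -> dob D j :=
  if j return L -> dob D j then fun l => f u (e l) else e.
pose tt j : dob D j -> M -> dob E j :=
  if j return dob D j -> M -> dob E j then @t n else @t m.
pose rho j : TL -> dob E j :=
  if j return TL -> dob E j then fun z => mx_act u^T (r z) else r.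
have limD : is_limit D pi.
  apply: equalizer_is_limit => //; split.
    by case=> //; exact: (lin_comp (fL u)).
  by case=> [] [] // [] l //=; rewrite eC.
have limE : is_limit E rho.
  apply: (flatM par_cat par_cat_finite D L pi limD E tt _ TL tL tLT rho).
  - split; first by case; exact: tT.
    by case=> [] [] // [] c x; exact: tact.
  - by case=> //; exact: (lin_comp (mx_act_lin _ _) rL).
  - by case=> x a; rewrite /= rE // tact.
(* The hypothesis on [y] places it in the equalizer of the tensored pair, which by flatness is the
   image of [TL]. *)
have [z zE] := equalizer_limitE limE yE.
have [s sE] := tLS z.
(* With z a finite sum of pure tensors, the left factors, seen in A^m, are the columns of w and the
   right factors form the new family. *)
exists (size s), (\matrix_(l, q) e (tnth (in_tuple s) q).1 l 0).
exists [ffun q => (tnth (in_tuple s) q).2]; split.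
  apply/matrixP => k q; move/matrixP/(_ k 0): (eC (tnth (in_tuple s) q).1).
  rewrite !mxE => h; under eq_bigr do rewrite mxE.
  by rewrite h; apply: eq_bigr => l _; rewrite mxE.
rewrite -zE /= sE (lin_sum _ _ rL); apply/ffunP => l.
rewrite sum_ffunE ffunE big_tnth; apply: eq_bigr => q _.
by rewrite rE !ffunE !mxE.
Qed.

(** * The category of elements of a module *)

Section Elements.
Variables (A : comPzSemiRingType) (M : lSemiModType A).

Let elt := {n : nat & {ffun 'I_n -> M}}.

(* A morphism is a matrix expressing the source family in terms of the target. *)
Let elt_hom (p q : elt) :=
  {U : 'M[A]_(projT1 p, projT1 q) | projT2 p == mx_act U^T (projT2 q)}.

Let elt_arrow p q U UP : elt_hom p q := exist _ U UP.

Lemma elt_id_subproof (p : elt) : projT2 p == mx_act (1%:M)^T (projT2 p).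
Proof. by rewrite trmx1 mx_act1. Qed.

Lemma elt_comp_subproof (p q r : elt) (g : elt_hom q r) (f : elt_hom p q) :
  projT2 p == mx_act (val f *m val g)^T (projT2 r).
Proof.
by rewrite trmx_mul mx_actM -(eqP (valP g)) -(eqP (valP f)).
Qed.

Definition elements : cat.
Proof.
refine (@Cat elt elt_hom (fun p => elt_arrow (elt_id_subproof p))
  (fun p q r g f => elt_arrow (elt_comp_subproof g f)) _ _ _).
(* The condition on an arrow is a boolean equation, so arrows with the same matrix are equal. *)
- by move=> p q f; apply: val_inj; rewrite /= mulmx1.
- by move=> p q f; apply: val_inj; rewrite /= mul1mx.
- by move=> p q r s h g f; apply: val_inj; rewrite /= mulmxA.
Defined.

Definition elements_diagram : diagram A elements.
Proof.
refine (@Diagram A elements (fun p : elt => 'rV[A]_(projT1 p) : lSemiModType A)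
  (fun p q (U : elt_hom p q) x => x *m val U) _ _ _).
- move=> p q U; split=> [|x y|a x]; first exact: mul0mx.
    exact: mulmxDl.
  by rewrite -scalemxAl.
- by move=> p x; rewrite /= mulmx1.
- by move=> p q r g f x; rewrite /= mulmxA.
Defined.

Let comb (p : elt) (c : 'rV[A]_(projT1 p)) : M := \sum_k c 0 k *: projT2 p k.
Arguments comb : clear implicits.

Lemma comb_cocone : is_cocone elements_diagram comb.
Proof.
split=> [p|p q f c].
  split=> [|x y|a x]; rewrite /comb.
  - by apply: big1 => k _; rewrite mxE scale0r.
  - by rewrite -big_split; apply: eq_bigr => k _; rewrite mxE scalerDl.
  - by rewrite scaler_sumr; apply: eq_bigr => k _; rewrite mxE scalerA.
rewrite /comb /=; case: f => U /= /eqP ->.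
under eq_bigr do rewrite mxE scaler_suml.
rewrite exchange_big; apply: eq_bigr => k _; rewrite ffunE scaler_sumr.
by apply: eq_bigr => l _; rewrite mxE scalerA.
Qed.

(** The concatenation of the two families is an upper bound, through the block matrices [1 0] and
    [0 1]. *)
Lemma elements_ub (p q : elements) :
  exists r : elements, inhabited (Hom p r) /\ inhabited (Hom q r).
Proof.
case: p q => [n x] [m y].
pose z : {ffun 'I_(n + m) -> M} :=
  [ffun l => match split l with inl i => x i | inr j => y j end].
have zl i : z (lshift m i) = x i.
  rewrite ffunE; case: splitP => j /= e; first by congr (x _); apply: val_inj.
  by have := ltn_ord i; rewrite e ltnNge leq_addr.
have zr j : z (rshift n j) = y j.
  rewrite ffunE; case: splitP => i /= e.
    by have := ltn_ord i; rewrite -e ltnNge leq_addr.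
  by congr (y _); apply/val_inj/(@addnI n).
clearbody z; exists (existT _ (n + m)%N z); split; constructor.
  exists (row_mx 1%:M 0); apply/eqP => /=.
  rewrite -[LHS]mx_act1; apply/ffunP => k; rewrite !ffunE big_split_ord /=.
  rewrite [X in _ = _ + X]big1 ?addr0 => [|i _].
    by apply: eq_bigr => i _; rewrite zl [in RHS]mxE row_mxEl !mxE eq_sym.
  by rewrite mxE row_mxEr mxE scale0r.
exists (row_mx 0 1%:M); apply/eqP => /=.
rewrite -[LHS]mx_act1; apply/ffunP => k; rewrite !ffunE big_split_ord /=.
rewrite [X in _ = X + _]big1 ?add0r => [|i _].
  by apply: eq_bigr => i _; rewrite zr [in RHS]mxE row_mxEr !mxE eq_sym.
by rewrite mxE row_mxEl mxE scale0r.
Qed.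

(** The empty family is an object. Parallel arrows u and v express the same family x through y, so u
    y = v y, and the equational criterion supplies the coequalizing arrow. *)
Lemma elements_filtered : tensor_preserves_finite_limits M -> filtered elements.
Proof.
move=> flatM; split; [by constructor; exists 0%N; exact: 0 | exact: elements_ub | ].
move=> [n x] [m y] [u uP] [v vP].
have [|p [w [z [wE zE]]]] := @flat_equational A M n m u v y flatM.
  by rewrite -(eqP uP) -(eqP vP).
exists (existT _ p z).
have wP : y == mx_act w^T z by apply/eqP.
by exists (@elt_arrow (existT _ m y) (existT _ p z) w wP); apply: val_inj.
Qed.

(** An element x is the value of [comb] on the generator of the one-element family x, which forces
    the mediating map. A row c is itself an arrow from the one-element family [comb p c] to [p], so
    any cocone is compatible with this choice. *)
Lemma elements_colimit : filtered elements -> is_colimit elements_diagram comb.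
Proof.
move=> hE; split; first exact: comb_cocone.
move=> L iota [iL iC]; have [cL cC] := comb_cocone.
pose pt (x : M) : elt := existT _ 1%N [ffun=> x].
pose u x := iota (pt x) 1%:M.
have uE p c : u (comb p c) = iota p c.
  have cP : projT2 (pt (comb p c)) == mx_act c^T (projT2 p).
    apply/eqP/ffunP => k; rewrite ord1 !ffunE; apply: eq_bigr => l _.
    by rewrite mxE.
  have := iC _ _ (@elt_arrow (pt (comb p c)) p c cP) 1%:M.
  by rewrite /= mul1mx.
have ptE x : comb (pt x) 1%:M = x.
  by rewrite /comb big_ord1 ffunE mxE eqxx scale1r.
exists u; split=> //.
  split=> [|x y|a x].
  - by rewrite -(lin0 (cL (pt 0))) uE (lin0 (iL _)).
  (* Additivity is checked at an upper bound of the two one-element families, where both elements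
     are combinations of the same family. *)
  - have [k [f [g _]]] := filtered_ub2 hE (pt x) (pt y).
    rewrite -(ptE x) -(ptE y) -(cC _ _ f) -(cC _ _ g) -(linD (cL k)).
    by rewrite !uE (linD (iL k)).
  - by rewrite -(ptE x) -(linZ (cL _)) !uE (linZ (iL _)).
by move=> v _ vE x; rewrite -(ptE x) vE uE.
Qed.

End Elements.

Theorem mainTheorem7 (A : comPzSemiRingType) (M : lSemiModType A) :
  flat M <-> filtered_colimit_of_finite_free M.
Proof.
split; last exact: filtered_colimit_of_finite_free_flat.
case=> flatM _; have hE := elements_filtered flatM.
have colim := elements_colimit hE.
exists (elements M), (elements_diagram M); eexists; split; [exact: hE | | exact: colim].
move=> p; exists (projT1 p), id; split; first exact: lin_id.
by exists id.
Qed.
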